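(* Let $N$ be a finite set and let $f: 2^{N} \to \mathbb{R} \cup \{-\infty\}$ be an M$^\natural$-concave function. Then $f$ has the multiple exchange property: for any $X, Y \subseteq N$ and any $I \subseteq X \setminus Y$, there exists $J \subseteq Y \setminus X$ such that $$f(X) + f(Y) \leq f((X \setminus I) \cup J) + f((Y \setminus J) \cup I).$$
   Context: For $f: 2^N \to \mathbb{R}\cup\{-\infty\}$, $\mathrm{dom}\, f = \{X \subseteq N : f(X) > -\infty\}$. Notation: $X - i = X \setminus \{i\}$, $Y + i = Y \cup \{i\}$, $X - i + j = (X\setminus\{i\})\cup\{j\}$, $Y + i - j = (Y \cup\{i\})\setminus\{j\}$. Conventions: $(-\infty)+a = a+(-\infty) = (-\infty)+(-\infty) = -\infty$ for $a \in \mathbb{R}$, $-\infty \le -\infty$, and a maximum over an empty set is $-\infty$. A function $f: 2^N \to \mathbb{R}\cup\{-\infty\}$ with $\mathrm{dom}\, f \neq \emptyset$ is M$^\natural$-concave if for all $X, Y \subseteq N$ and $i \in X \setminus Y$: $$f(X)+f(Y) \le \max\Big[ f(X-i)+f(Y+i),\ \max_{j \in Y\setminus X}\{ f(X-i+j)+f(Y+i-j)\}\Big].$$ *)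

(* Defs.v *)
(* Extended reals R ∪ {-∞} are modelled as [option R],
   with [None] = -∞ and [Some x] = x. R is any real field (covers ℝ). *)
From HB Require Import structures.
From mathcomp Require Import all_boot all_order all_algebra.
Set Implicit Arguments. Unset Strict Implicit. Unset Printing Implicit Defensive.
Import Order.TTheory GRing.Theory Num.Theory.
Local Open Scope ring_scope.

Definition ext (R : realFieldType) := option R.

Definition eadd (R : realFieldType) (a b : ext R) : ext R :=
  match a, b with
  | Some x, Some y => Some (x + y)
  | _, _ => None
  end.

Definition ele (R : realFieldType) (a b : ext R) : bool :=
  match a, b with
  | None, _ => true
  | Some _, None => false
  | Some x, Some y => x <= y
  end.

Definition emax (R : realFieldType) (a b : ext R) : ext R :=
  if ele a b then b else a.

Definition dom (R : realFieldType) (N : finType) (f : {set N} -> ext R) :=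
  [set X : {set N} | f X != None].

Definition Mnat_concave (R : realFieldType) (N : finType)
    (f : {set N} -> ext R) : Prop :=
  dom f != set0 /\
  forall (X Y : {set N}) (i : N), i \in X :\: Y ->
    ele (eadd (f X) (f Y))
        (emax (eadd (f (X :\ i)) (f (i |: Y)))
              (\big[@emax R/None]_(j in Y :\: X)
                  eadd (f (j |: (X :\ i))) (f ((i |: Y) :\ j)))).

(* Main.v *)
(* Replacing f(X) by the maximum of f(Z) - C d(X, Z) over Z in dom f, with d the
   Hamming distance and C large, makes f finite and keeps it M-natural-concave.  For finite g over an archimedean
   field, view v(J) = g((X \ I) + J) and w(J) = g((X & Y) + I + J),
   J <= Y \ X, as the valuations of two agents: exchange makes them gross
   substitutes, so an ascending auction with increment eps ends in prices p and
   a split of Y \ X in which each agent is eps-optimal.  It thus suffices to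
   bound max (v - p) + max (w - p) from below, which is submodularity of the
   partial maximization of g - p over the elements of Y \ X, itself
   M-natural-concave.  Finally eps -> 0.  The auction only terminates over an
   archimedean field; over a general ordered field, g is first replaced by a
   rational function with the same comparisons between sums of two values. *)
Require Import Defs.
From HB Require Import structures.
From mathcomp Require Import all_boot all_order all_algebra.
From mathcomp Require Import archimedean zify lra ring.
Set Implicit Arguments. Unset Strict Implicit. Unset Printing Implicit Defensive.
Import Order.TTheory GRing.Theory Num.Theory.
Local Open Scope ring_scope.

(** * Finite-valued M-natural-concave functions and operations that preserve exchange *)

Definition fin_mnat (R : realFieldType) (N : finType) (g : {set N} -> R) :=
  forall (X Y : {set N}) (i : N), i \in X :\: Y ->
    g X + g Y <= g (X :\ i) + g (i |: Y) \/
    exists2 j, j \in Y :\: X &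
      g X + g Y <= g (j |: (X :\ i)) + g ((i |: Y) :\ j).

Section FiniteMnat.
Variables (R : realFieldType) (N : finType).
Implicit Types (g v w : {set N} -> R) (p q : N -> R) (X Y Z W A B U S : {set N}).

(** Induction on the size of [A :\: B]. Exchanging [i] between [A :|: B] and its subset [A :\ i]
    leaves no candidate [j]; the inequality obtained adds to the induction hypothesis for
    [A :\ i]. *)
Lemma mnat_submod g : fin_mnat g ->
  forall A B, g (A :|: B) + g (A :&: B) <= g A + g B.
Proof.
move=> gM A B; move: {2}#|_| (erefl #|A :\: B|) => n.
elim: n A => [|n IH] A.
  move/eqP; rewrite cards_eq0 setD_eq0 => AB.
  by rewrite (setUidPr AB) (setIidPl AB) addrC.
move=> cAB; have /card_gt0P[i iAB] : (0 < #|A :\: B|)%N by rewrite cAB.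
have [iA iB] : i \in A /\ i \notin B by move: iAB; rewrite inE => /andP[].
have cA' : #|(A :\ i) :\: B| = n.
  by move: cAB; rewrite (cardsD1 i) iAB setDDl setUC -setDDl => -[].
have := IH _ cA'.
have -> : (A :\ i) :|: B = (A :|: B) :\ i.
  by apply/setP => e; rewrite !inE; case: eqVneq => // ->; rewrite (negPf iB).
have -> : (A :\ i) :&: B = A :&: B.
  by apply/setP => e; rewrite !inE; case: eqVneq => // ->; rewrite (negPf iB) !andbF.
have /gM : i \in (A :|: B) :\: (A :\ i) by rewrite !inE eqxx iA.
rewrite setD1K // => -[|[j]]; first lra.
by rewrite !inE; case: (j \in A); rewrite ?andbF.
Qed.

Definition cost p X := \sum_(e in X) p e.

Lemma cost_setU1 p X i : i \notin X -> cost p (i |: X) = p i + cost p X.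
Proof. exact: big_setU1. Qed.

Lemma cost_setD1 p X i : i \in X -> cost p X = p i + cost p (X :\ i).
Proof. exact: big_setD1. Qed.

Lemma mnat_price g p : fin_mnat g -> fin_mnat (fun X => g X - cost p X).
Proof.
move=> gM X Y i iXY; have [iY iX] : i \notin Y /\ i \in X.
  by move: iXY; rewrite inE => /andP[].
have eX := cost_setD1 p iX.
have eY := cost_setU1 p iY.
case: (gM X Y i iXY) => [h|[j jYX h]]; first by left; lra.
right; exists j => //; move: jYX; rewrite inE => /andP[jX jY].
have jXi : j \notin X :\ i by rewrite inE negb_and jX orbT.
have jiY : j \in i |: Y by rewrite inE jY orbT.
have eXj := cost_setU1 p jXi; have eYj := cost_setD1 p jiY; lra.
Qed.

(** Provides the valuations of both agents, [U] being the items for sale; intersecting with [U] lets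
    them be defined on all sets. *)
Lemma mnat_restrict g S U : [disjoint S & U] -> fin_mnat g ->
  fin_mnat (fun J => g (S :|: (J :&: U))).
Proof.
move=> dSU gM X Y i; rewrite inE => /andP[iY iX].
have [iU|iU] := boolP (i \in U); last first.
  left; rewrite le_eqVlt; apply/orP; left; apply/eqP; congr (g _ + g _);
  by apply/setP => e; rewrite !inE; case: eqVneq => // ->; rewrite (negPf iU) !andbF.
have iS : i \notin S by apply/negP => iS; rewrite (disjointFr dSU iS) in iU.
have /gM : i \in (S :|: X :&: U) :\: (S :|: Y :&: U).
  by rewrite !inE iU iX (negPf iS) (negPf iY).
have -> : (S :|: X :&: U) :\ i = S :|: (X :\ i) :&: U.
  apply/setP => e; rewrite !inE; case: eqVneq => // ->; rewrite (negPf iS) //.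
have -> : i |: (S :|: Y :&: U) = S :|: (i |: Y) :&: U.
  by apply/setP => e; rewrite !inE; case: eqVneq => // ->; rewrite iU orbT.
case=> [h|[j]]; first by left.
rewrite !inE negb_or => /andP[/andP[jS]].
rewrite (negPf jS) /= => jX /andP[jY jU]; rewrite jU andbT in jX.
move=> h; right; exists j; first by rewrite inE jX.
congr (_ <= g _ + g _): h; apply/setP => e; rewrite !inE; case: eqVneq => // ->.
  by rewrite jU orbT.
by rewrite (negPf jS).
Qed.

(** Partial maximization over the elements of [U]; it depends on [S :\: U] alone. *)
Definition proj g U S := g [arg max_(Z > S | Z :\: U == S :\: U) g Z]%O.

Lemma proj_ge g U S Z : Z :\: U = S :\: U -> g Z <= proj g U S.
Proof.
by move=> ZS; rewrite /proj; case: Order.TotalTheory.arg_maxP => // W _; apply; apply/eqP.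
Qed.

Lemma proj_attained g U S : exists2 Z, Z :\: U = S :\: U & proj g U S = g Z.
Proof.
by rewrite /proj; case: Order.TotalTheory.arg_maxP => // Z /eqP ZS _; exists Z.
Qed.

Lemma eq_setD U Z S : Z :\: U = S :\: U -> {in ~: U, Z =i S}.
Proof. by move=> /setP h e; rewrite inE => eU; have := h e; rewrite !inE eU. Qed.

(** Exchange is applied to maximizers [Z] and [W]. Elements of [U] are invisible to the projection,
    so a [j] in [U] yields the first alternative. *)
Lemma mnat_proj g U : fin_mnat g -> fin_mnat (proj g U).
Proof.
move=> gM X Y i; rewrite inE => /andP[iY iX].
have [Z ZX ->] := proj_attained g U X; have [W WY ->] := proj_attained g U Y.
have [iU|iU] := boolP (i \in U).
  left; apply: lerD; apply: proj_ge; rewrite (ZX, WY);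
  by apply/setP => e; rewrite !inE; case: eqVneq => // ->; rewrite iU.
have eZ := eq_setD ZX; have eW := eq_setD WY.
have : i \in Z :\: W by rewrite !inE eZ ?eW ?iX ?inE // iY.
have eUi T S k : T :\: U = S :\: U -> (k |: T) :\: U = (k |: S) :\: U.
  by move=> TS; rewrite !setDUl TS.
have eDk T S k : T :\: U = S :\: U -> (T :\ k) :\: U = (S :\ k) :\: U.
  by move=> TS; rewrite setDDl setUC -setDDl TS setDDl setUC -setDDl.
case/gM => [h|[j jWZ h]].
  by left; apply: le_trans h _; apply: lerD; apply: proj_ge; [apply: eDk|apply: eUi].
have [jU|jU] := boolP (j \in U).
  left; apply: le_trans h _; apply: lerD; apply: proj_ge.
    rewrite -(eDk _ _ i ZX).
    by apply/setP => e; rewrite !inE; case: eqVneq => // ->; rewrite jU.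
  rewrite -(eUi _ _ i WY).
  by apply/setP => e; rewrite !inE; case: eqVneq => // ->; rewrite jU.
right; exists j.
  by move: jWZ; rewrite !inE eW ?eZ ?inE.
apply: le_trans h _; apply: lerD; apply: proj_ge; first exact/eUi/eDk.
exact/eDk/eUi.
Qed.

(** * Demand and the gross substitutes property *)

Definition demanded v p A :=
  forall B, v B - cost p B <= v A - cost p A.

Lemma demanded_exists v p : exists A, demanded v p A.
Proof.
exists [arg max_(A > set0) (v A - cost p A)]%O.
by case: Order.TotalTheory.arg_maxP => // A _ h B; apply: h.
Qed.

Lemma demanded_eq v p q A : p =1 q -> demanded v p A -> demanded v q A.
Proof.
move=> pq h B; have costE C : cost q C = cost p C.
  by apply: eq_bigr => e _; rewrite pq.
by rewrite !costE.
Qed.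

(** Among the bundles demanded at [q], take one keeping as many as possible of the items of [A]
    whose price is unchanged. If such an item [a] were missing, exchange with [A] would give a
    bundle as good at [q] that keeps more: [a] has the same price, and a dropped [b] costs no less
    at [q] than at [p]. *)
Lemma gross_substitutes v p q A : fin_mnat v -> (forall e, p e <= q e) ->
  demanded v p A ->
  exists2 B, demanded v q B & forall a, a \in A -> p a = q a -> a \in B.
Proof.
move=> vM pq dA.
pose A' := [set a in A | p a == q a].
have [B0 dB0] := demanded_exists v q.
pose dem B := [forall C : {set N}, v C - cost q C <= v B - cost q B].
have demP B : reflect (demanded v q B) (dem B) by apply: forallP.
case: (@arg_maxnP _ B0 dem (fun B => #|B :&: A'|)); first exact/demP.
move=> B /demP dB mB; exists B => // a aA pqa; apply/negPn/negP => aB.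
have aA' : a \in A' by rewrite inE aA pqa eqxx.
suff [B' dB' lt] : exists2 B', demanded v q B' & (#|B :&: A'| < #|B' :&: A'|)%N.
  by have /= := mB B' (introT (demP B') dB'); rewrite leqNgt lt.
have add S : a \in S -> B :&: A' \subset S -> (#|B :&: A'| < #|S :&: A'|)%N.
  move=> aS sS; apply: proper_card; apply/properP; split.
    by rewrite subsetI sS subsetIr.
  by exists a; rewrite inE ?aA' ?andbT // (negPf aB).
have : a \in A :\: B by rewrite inE aB aA.
have eA := cost_setD1 p aA.
have eB := cost_setU1 q aB.
case/vM => [h|[b]].
  exists (a |: B); last by apply: add; rewrite ?setU11 // subIset // subsetUr.
  move=> C; apply: le_trans (dB C) _.
  by have := dA (A :\ a); lra.
rewrite inE => /andP[bA bB] h.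
have bAa : b \notin A :\ a by rewrite inE negb_and bA orbT.
have bBa : b \in a |: B by rewrite inE bB orbT.
have eAb := cost_setU1 p bAa.
have eBb := cost_setD1 q bBa.
have ab : a != b by apply: contraNneq bA => <-.
exists ((a |: B) :\ b).
  move=> C; apply: le_trans (dB C) _.
  by have := dA (b |: (A :\ a)); have := pq b; lra.
apply: add; first by rewrite !inE ab eqxx.
apply/subsetP => e; rewrite !inE => /and3P[eB' eA' _]; rewrite eB' orbT andbT.
by apply: contraNneq bA => <-.
Qed.

End FiniteMnat.

(** * An ascending auction between two agents holding complementary bundles *)

Section Auction.
Variables (R : realFieldType) (N : finType) (eps C : R).
Hypothesis eps_gt0 : 0 < eps.
Implicit Types (v w : {set N} -> R) (k : N -> nat) (A B D X Y : {set N}).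

(* The price seen by an agent holding A: the current price k e * eps - C, plus one
   increment on the items it does not hold. *)
Definition ask k A (e : N) : R := (k e + (e \notin A))%:R * eps - C.

(** The auction invariant: the agent is content to keep all of [A], though it may want more. *)
Definition holds v k A := exists2 D, demanded v (ask k A) D & A \subset D.

(** An unsatisfied first agent takes all of [D], which raises the price of the new items by one
    increment. Its own asking prices stay the same; those of the other agent rise only on the items
    it loses, so by gross substitutes it still holds the rest. *)
Lemma auction_step v w (K : nat) k A : fin_mnat v -> fin_mnat w ->
  (forall X Y, v X - v Y <= K%:R * eps - C) ->
  holds v k A -> holds w k (~: A) -> (forall e, k e <= K)%N ->
  demanded v (ask k A) A \/
  exists k' A', [/\ holds v k' A', holds w k' (~: A'),
    (forall e, k' e <= K)%N & (\sum_e k e < \sum_e k' e)%N].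
Proof.
move=> vM wM vK [D dD sAD] [D2 dD2 sD2] kK.
have [eDA|nAD] := eqVneq D A; first by left; rewrite eDA in dD.
right; pose k' e := (k e + (e \in D :\: A))%N; exists k', D.
have ask1 : ask k A =1 ask k' D.
  move=> e; rewrite /ask /k' inE; congr (_%:R * _ - _).
  have := subsetP sAD e; case: (e \in A) => [/(_ isT) -> | _];
    by rewrite ?andbF; case: (e \in D) => /=; rewrite ?addn0 ?addn1.
have ask2 e : ask k (~: A) e <= ask k' (~: D) e.
  rewrite lerD2r; apply: ler_wpM2r; first exact: ltW.
  rewrite ler_nat /k' !inE.
  have := subsetP sAD e; case: (e \in A) => [/(_ isT) -> | _];
    by case: (e \in D) => /=; lia.
have ask2_eq e : e \notin D -> ask k (~: A) e = ask k' (~: D) e.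
  move=> eD; rewrite /ask /k' !inE (negPf eD) /=.
  by have /contraNN/(_ eD)/negPf -> := subsetP sAD e; rewrite addn0.
split.
- by exists D => //; apply: demanded_eq dD.
- have [B dB sB] := gross_substitutes wM ask2 dD2.
  exists B => //; apply/subsetP => e; rewrite inE => eD.
  apply: sB; last exact: ask2_eq.
  by apply: (subsetP sD2); rewrite inE; apply: contra eD; apply: (subsetP sAD).
- move=> e; rewrite /k' inE.
  have [eA|eA] := boolP (e \in A); first by rewrite addn0.
  have [eD|eD] := boolP (e \in D); last by rewrite addn0.
  (* A demanded item costs at most its marginal value, which [vK] bounds by the price at level
     [K]. *)
  rewrite -(ler_nat R) -(ler_pM2r eps_gt0).
  have := dD (D :\ e); rewrite (cost_setD1 _ eD).
  by have := vK D (D :\ e); rewrite /ask eA /=; lra.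
have /properP[_ [e eD eA]] : A \proper D.
  by rewrite properEneq eq_sym nAD.
rewrite (bigD1 e) // [X in (_ < X)%N](bigD1 e) //=.
have : (\sum_(i | i != e) k i <= \sum_(i | i != e) k' i)%N.
  by apply: leq_sum => i _; rewrite leq_addr.
have -> : k' e = (k e).+1 by rewrite /k' inE eD eA addn1.
by rewrite addSn ltnS => ?; apply: leq_add.
Qed.

(** Levels stay below [K] and their sum grows, so [n] bounds the number of steps left. When the
    first agent is satisfied, the second bids, with [A] and its complement swapped. *)
Lemma auction_terminates v w (K : nat) : fin_mnat v -> fin_mnat w ->
  (forall X Y, v X - v Y <= K%:R * eps - C) ->
  (forall X Y, w X - w Y <= K%:R * eps - C) ->
  forall k A, holds v k A -> holds w k (~: A) -> (forall e, k e <= K)%N ->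
  exists k' A', demanded v (ask k' A') A' /\ demanded w (ask k' (~: A')) (~: A').
Proof.
move=> vM wM vK wK k A.
have [n] : exists n, (K * #|N| < \sum_e k e + n)%N.
  by exists (K * #|N|).+1; rewrite addnS ltnS leq_addl.
elim: n k A => [|n IH] k A lt_n vA wA kK.
  move: lt_n; rewrite addn0 ltnNge mulnC -sum_nat_const.
  by move/negP; case; apply: leq_sum.
have [dv|[k' [A' [vA' wA' kK' lt]]]] := auction_step vM wM vK vA wA kK; last first.
  by apply: (IH k' A') => //; lia.
have vA2 : holds v k (~: ~: A) by rewrite setCK.
have [dw|[k' [A' [wA' vA' kK' lt]]]] := auction_step wM vM wK wA vA2 kK; last first.
  by apply: (IH k' (~: A')); rewrite ?setCK //; lia.
by exists k, A.
Qed.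

End Auction.

Lemma approx_equilibrium (R : archiRealFieldType) (N : finType)
    (v w : {set N} -> R) (eps : R) :
  fin_mnat v -> fin_mnat w -> 0 < eps ->
  exists (p : N -> R) (A : {set N}),
    (forall B, v B - cost p B <= v A - cost p A + eps) /\
    (forall B, w B - cost p B <= w (~: A) - cost p (~: A) + eps).
Proof.
move=> vM wM eps_gt0.
(* One such increment on every item costs at most [eps] in total. *)
pose d := eps / #|N|.+1%:R.
have d_gt0 : 0 < d by rewrite divr_gt0.
pose M := \sum_(X : {set N}) (`|v X| + `|w X|).
have vwM X : `|v X| + `|w X| <= M.
  by rewrite /M (bigD1 X) //= lerDl sumr_ge0 // => Y _; rewrite addr_ge0.
have bnd X Y : v X - v Y <= 2 * M /\ w X - w Y <= 2 * M.
  have := vwM X; have := vwM Y.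
  have := ler_norm (v X); have := ler_norm (- v Y); rewrite normrN.
  have := ler_norm (w X); have := ler_norm (- w Y); rewrite normrN.
  have := normr_ge0 (v X); have := normr_ge0 (v Y).
  have := normr_ge0 (w X); have := normr_ge0 (w Y); lra.
have M_ge0 : 0 <= M by have := vwM set0; apply: le_trans; rewrite addr_ge0.
have [K leK] : exists K : nat, 4 * M <= K%:R * d.
  have /archi_boundP : 0 <= 4 * M / d by apply: divr_ge0; [apply: mulr_ge0|apply: ltW].
  by set K := Num.bound _ => h; exists K; rewrite -ler_pdivrMr // ltW.
(* At the starting price [- C] the first agent demands everything, and the price at level [K] is at
   least every difference of two values. *)
pose C := 2 * M.
have vK X Y : v X - v Y <= K%:R * d - C by have [] := bnd X Y; rewrite /C; lra.
have wK X Y : w X - w Y <= K%:R * d - C by have [] := bnd X Y; rewrite /C; lra.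
have v0 : holds d C v (fun=> 0%N) setT.
  exists setT => // B.
  have costE X : cost (ask d C (fun=> 0%N) setT) X = - C * #|X|%:R.
    rewrite /cost (eq_bigr (fun=> - C)); first by rewrite sumr_const mulr_natr.
    by move=> e _; rewrite /ask inE /= mul0r sub0r.
  rewrite !costE; have [->|BT] := eqVneq B setT => //.
  have ltB : (#|B| < #|[set: N]|)%N.
    by apply: proper_card; rewrite properEneq BT subsetT.
  have : C * (#|B|.+1)%:R <= C * #|[set: N]|%:R.
    by rewrite ler_wpM2l ?ler_nat ?mulr_ge0.
  by rewrite -natr1 mulrDr mulr1; have [] := bnd B setT; rewrite /C; lra.
have w0 : holds d C w (fun=> 0%N) (~: setT).
  have [D dD] := demanded_exists w (ask d C (fun=> 0%N) (~: setT)).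
  by exists D => //; rewrite setCT sub0set.
have [//|k [A [dv dw]]] := auction_terminates d_gt0 vM wM vK wK v0 w0.
pose p e := (k e)%:R * d - C.
exists p, A.
have ask_ge A' X : cost p X <= cost (ask d C k A') X.
  by apply: ler_sum => e _; rewrite /p /ask natrD mulrDl; case: (_ \notin _) => /=; lra.
have ask_le A' X : cost (ask d C k A') X <= cost p X + eps.
  apply: (@le_trans _ _ (\sum_(e in X) (p e + d))).
    by apply: ler_sum => e _; rewrite /p /ask natrD mulrDl; case: (_ \notin _) => /=; lra.
  rewrite big_split /= lerD2l sumr_const -mulr_natr /d mulrAC ler_pdivrMr //.
  by rewrite ler_pM2l // ler_nat ltnW // ltnS max_card.
split=> B.
  have := dv B; have := ask_ge A A; have := ask_le A B; lra.
have := dw B; have := ask_ge (~: A) (~: A); have := ask_le (~: A) B; lra.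
Qed.

(** * Multiple exchange over an archimedean field, first up to [eps] *)

Lemma approx_multiple_exchange (R : archiRealFieldType) (N : finType)
    (g : {set N} -> R) (X Y I : {set N}) (eps : R) :
  fin_mnat g -> I \subset X :\: Y -> 0 < eps ->
  exists2 J : {set N}, J \subset Y :\: X &
    g X + g Y <= g ((X :\: I) :|: J) + g ((Y :\: J) :|: I) + eps.
Proof.
(* The items of [U] are for sale; [S1] and [S2], with union [X] and intersection [X :&: Y], are what
   the agents own beforehand. *)
move=> gM sI eps_gt0; pose U := Y :\: X.
pose S1 := X :\: I; pose S2 := (X :&: Y) :|: I.
have sIe e : e \in I -> (e \in X) && (e \notin Y).
  by move/(subsetP sI); rewrite inE andbC.
have dis1 : [disjoint S1 & U].
  by rewrite -setI_eq0; apply/eqP/setP => e; rewrite !inE; case: (e \in X); rewrite ?andbF.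
have dis2 : [disjoint S2 & U].
  rewrite -setI_eq0; apply/eqP/setP => e; rewrite !inE.
  by have := sIe e; case: (e \in I) => [/(_ isT)/andP[-> _]|_];
    case: (e \in X); rewrite ?andbF.
have [p [A [dA dAC]]] := approx_equilibrium (mnat_restrict dis1 gM)
  (mnat_restrict dis2 gM) (divr_gt0 eps_gt0 (ltr0n R 2)).
exists (A :&: U); first exact: subsetIr.
pose pU e := if e \in U then p e else 0.
have costU Z : cost pU Z = cost p (Z :&: U).
  by rewrite /cost (big_setID U) /= [X in _ + X]big1 ?addr0 => [|e];
    [apply: eq_bigr => e; rewrite !inE /pU !inE => /andP[_ ->] |
     rewrite inE /pU => /andP[/negPf ->]].
have IU Z W : (Z :&: U :|: W :\: U) :&: U = Z :&: U.
  by apply/setP => e; rewrite !inE; case: (e \in Y); case: (e \in X);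
    rewrite ?andbF ?orbF ?andbT.
have cost_split Z W : cost p ((Z :&: U) :|: (W :\: U)) = cost pU Z + cost p (W :\: U).
  rewrite costU {1}/cost (big_setID U) /= IU; congr (_ + _); congr (cost p _).
  by apply/setP => e; rewrite !inE; case: (e \in Y); case: (e \in X);
    rewrite ?andbF ?orbF ?andbT.
(* [h S1] and [h S2] are the best profits of the two agents; by submodularity their sum is at least
   [h X + h (X :&: Y)], for which [X] and [Y] are candidates. *)
pose h := proj (fun Z => g Z - cost pU Z) U.
have hM : fin_mnat h by apply: mnat_proj; apply: mnat_price.
have := mnat_submod hM S1 S2.
have -> : S1 :|: S2 = X.
  apply/setP => e; rewrite !inE; have := sIe e.
  by case: (e \in I) => [/(_ isT)/andP[-> _]|_]; case: (e \in X); rewrite ?orbT.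
have -> : S1 :&: S2 = X :&: Y.
  apply/setP => e; rewrite !inE; have := sIe e.
  by case: (e \in I) => [/(_ isT)/andP[-> /negPf->]|_]; case: (e \in X); rewrite /= ?orbF.
have attain (S : {set N}) : [disjoint S & U] -> exists2 Z, g Z = g (S :|: Z :&: U) &
    h S = g Z - cost pU Z.
  move=> dSU; have [Z eZ eh] := proj_attained (fun Z => g Z - cost pU Z) U S.
  by exists Z => //; congr g; rewrite -{1}(setID Z U) eZ (setDidPl dSU) setUC.
have [Z1 gZ1 ->] := attain _ dis1; have [Z2 gZ2 ->] := attain _ dis2.
have hX : g X <= h X.
  apply: le_trans (@proj_ge _ _ (fun Z => g Z - cost pU Z) _ _ _ (erefl (X :\: U))).
  rewrite costU; suff -> : X :&: U = set0 by rewrite /cost big_set0 subr0.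
  by apply/setP => e; rewrite !inE; case: (e \in X); rewrite ?andbF.
have hY : g Y - cost pU Y <= h (X :&: Y).
  apply: (@proj_ge _ _ (fun Z => g Z - cost pU Z)); apply/setP => e; rewrite !inE.
  by case: (e \in X); case: (e \in Y).
(* The competing bundles agree with [A] and [~: A] outside [U], so the prices of items not for sale
   cancel. *)
have := dA (Z1 :&: U :|: A :\: U); have := dAC (Z2 :&: U :|: (~: A) :\: U).
rewrite !IU -gZ1 -gZ2 !cost_split.
have -> : S2 :|: ~: A :&: U = (Y :\: A :&: U) :|: I.
  apply/setP => e; rewrite !inE; have := sIe e.
  case: (e \in I) => [/(_ isT)/andP[-> /negPf->]|_] //=;
  by case: (e \in X); case: (e \in Y); case: (e \in A).
have costID W : cost p W = cost pU W + cost p (W :\: U).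
  by rewrite costU /cost (big_setID U).
have costC : cost pU A + cost pU (~: A) = cost pU Y.
  rewrite !costU /cost [RHS](big_setID A) /=.
  congr (_ + _); apply: eq_bigl => e; rewrite !inE;
  by case: (e \in X); case: (e \in Y); case: (e \in A).
rewrite (costID A) (costID (~: A)); lra.
Qed.

(** There are finitely many [J]: if the best one failed, half its deficit taken as [eps] would
    contradict the approximate version. *)
Lemma arch_multiple_exchange (R : archiRealFieldType) (N : finType)
    (g : {set N} -> R) (X Y I : {set N}) :
  fin_mnat g -> I \subset X :\: Y ->
  exists2 J : {set N}, J \subset Y :\: X &
    g X + g Y <= g ((X :\: I) :|: J) + g ((Y :\: J) :|: I).
Proof.
move=> gM sI; pose F J := g ((X :\: I) :|: J) + g ((Y :\: J) :|: I).
pose J := [arg max_(J > set0 | J \subset Y :\: X) F J]%O.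
have [sJ maxJ] : J \subset Y :\: X /\ forall J' : {set N}, J' \subset Y :\: X -> F J' <= F J.
  by rewrite /J; case: Order.TotalTheory.arg_maxP => [|J' ? h]; rewrite ?sub0set.
exists J => //; rewrite -/(F J) leNgt; apply/negP => lt.
have gap : 0 < (g X + g Y - F J) / 2 by lra.
have [J' sJ'] := approx_multiple_exchange gM sI gap.
by rewrite -/(F J'); have := maxJ _ sJ'; lra.
Qed.

(** * Replacing an ordered field by the rationals *)

Lemma seq_separation (R : realFieldType) (L U : seq R) :
  (forall l u, l \in L -> u \in U -> l < u) ->
  exists y, (forall l, l \in L -> l < y) /\ (forall u, u \in U -> y < u).
Proof.
move=> LU.
have max_seq (s : seq R) : s = [::] \/ exists2 m, m \in s & forall z, z \in s -> z <= m.
  elim: s => [|z s [->|[m ms mP]]]; first by left.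
    by right; exists z; rewrite ?mem_head // => t; rewrite inE => /eqP ->.
  right; exists (Num.max z m).
    by rewrite inE; case: leP => _; rewrite ?eqxx ?ms ?orbT.
  by move=> t; rewrite inE le_max => /orP[/eqP ->|/mP ->]; rewrite ?lexx ?orbT.
have min_seq (s : seq R) : s = [::] \/ exists2 m, m \in s & forall z, z \in s -> m <= z.
  have [|[m]] := max_seq (map -%R s); first by case: s => //; left.
  case/mapP => z zs -> mP; right; exists z => // t ts.
  by rewrite -lerN2; apply: mP; apply: map_f.
have [->|[l lL lP]] := max_seq L; have [->|[u uU uP]] := min_seq U.
- by exists 0.
- by exists (u - 1); split=> // t /uP; lra.
- by exists (l + 1); split=> // t /lP; lra.
- by exists ((l + u) / 2); split=> t => [/lP|/uP]; have := LU _ _ lL uU; lra.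
Qed.

(** Extends an order-preserving correspondence of finitely many values by one point: [x] either
    equals some [u a] or falls in a gap, and the matching gap in [Q] contains a point. *)
Lemma same_cut (R Q : realFieldType) (T : eqType) (s : seq T) (u : T -> R) (v : T -> Q) x :
  {in s &, forall a b, (u a < u b) = (v a < v b)} ->
  exists y, {in s, forall a, (u a < x) = (v a < y) /\ (x < u a) = (y < v a)}.
Proof.
move=> uv.
have [/hasP[a as_ /eqP ua]|/hasPn nx] := boolP (has (fun a => u a == x) s).
  by exists (v a) => b bs; rewrite -ua !uv.
have [|y [Ly Uy]] := @seq_separation Q [seq v a | a <- s & u a < x]
    [seq v a | a <- s & x < u a].
  move=> l t /mapP[a]; rewrite mem_filter => /andP[ax as_] ->.
  move=> /mapP[b]; rewrite mem_filter => /andP[xb bs] ->.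
  by rewrite -uv //; apply: lt_trans xb.
exists y => a as_; have := nx a as_; rewrite neq_lt => /orP[ltx|gtx].
  have h : v a < y by apply: Ly; apply/mapP; exists a; rewrite ?mem_filter ?ltx.
  by rewrite ltx h !ltNge !(ltW ltx) !(ltW h).
have h : y < v a by apply: Uy; apply/mapP; exists a; rewrite ?mem_filter ?gtx.
by rewrite gtx h !ltNge !(ltW gtx) !(ltW h).
Qed.

(** Rational coefficients allow one form to be evaluated over different ordered fields. *)
Definition lin (R : realFieldType) n (c : seq rat) (x : nat -> R) : R :=
  \sum_(i < n) ratr c`_i * x i.

(* Induction on the number of variables: the last one is placed in the same cut
   of the values of the other terms, whose relative order the induction
   hypothesis preserves. *)
Lemma rational_signs (R : realFieldType) n (s : seq (seq rat)) (x : nat -> R) :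
  exists y : nat -> rat, {in s, forall c,
    (0 < lin n c x) = (0 < lin n c y) /\ (lin n c x < 0) = (lin n c y < 0)}.
Proof.
elim: n s => [|n IH] s; first by exists (fun=> 0) => c _; rewrite /lin !big_ord0 ltxx.
(* When the last coefficient of [c] is nonzero, [b c] gives the threshold of the last variable at
   which [c] vanishes. *)
pose b (c : seq rat) := [seq - c`_i / c`_n | i <- iota 0 n].
pose diff (c d : seq rat) := [seq c`_i - d`_i | i <- iota 0 n].
have lin_b (Q : realFieldType) c (z : nat -> Q) :
    lin n (b c) z = - (ratr c`_n)^-1 * lin n c z.
  rewrite /lin mulr_sumr; apply: eq_bigr => i _.
  rewrite (nth_map 0%N) ?size_iota // nth_iota // add0n.
  by rewrite rmorphM rmorphN fmorphV /=; ring.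
have lin_diff (Q : realFieldType) c d (z : nat -> Q) :
    lin n (diff c d) z = lin n c z - lin n d z.
  rewrite /lin -sumrB; apply: eq_bigr => i _.
  by rewrite (nth_map 0%N) ?size_iota // nth_iota // add0n rmorphB /=; ring.
have diff_lt0 (Q : realFieldType) c d (z : nat -> Q) :
  (lin n (diff c d) z < 0) = (lin n c z < lin n d z) by rewrite lin_diff subr_lt0.
(* The differences fix the order of the thresholds; [s] itself serves the forms whose last
   coefficient is zero. *)
have [y0 y0P] := IH (s ++ [seq diff (b c) (b d) | c <- s, d <- s]).
have [|yn ynP] := @same_cut R rat _ s (fun c => lin n (b c) x) (fun c => lin n (b c) y0) (x n).
  move=> c d cs ds.
  have [] := y0P (diff (b c) (b d)).
    by rewrite mem_cat; apply/orP; right; apply: allpairs_f.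
  by rewrite !diff_lt0.
exists (fun i => if i == n then yn else y0 i) => c cs.
have lin_y d : lin n d (fun i => if i == n then yn else y0 i) = lin n d y0.
  by apply: eq_bigr => i _; rewrite ltn_eqF.
have linS (Q : realFieldType) (z : nat -> Q) :
  lin n.+1 c z = lin n c z + ratr c`_n * z n by rewrite /lin big_ord_recr.
set y := fun i => _.
have [cn0|cn0] := eqVneq c`_n 0.
  have linS0 (Q : realFieldType) (z : nat -> Q) : lin n.+1 c z = lin n c z.
    by rewrite linS cn0 rmorph0 mul0r addr0.
  by rewrite !linS0 lin_y; apply: y0P; rewrite mem_cat cs.
have linE (Q : realFieldType) (z : nat -> Q) :
    lin n.+1 c z = ratr c`_n * (z n - lin n (b c) z).
  have : ratr c`_n != 0 :> Q by rewrite fmorph_eq0.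
  by rewrite linS lin_b => ?; field.
have [] := ynP c cs; rewrite -lin_y -/y (_ : yn = y n); last by rewrite /y eqxx.
move: cn0; rewrite neq_lt => /orP[lt|gt].
  have signs (Q : realFieldType) (z : nat -> Q) :
      (0 < lin n.+1 c z) = (z n < lin n (b c) z) /\
      (lin n.+1 c z < 0) = (lin n (b c) z < z n).
    have ltQ : ratr c`_n < 0 :> Q by rewrite ltrq0.
    by rewrite linE (nmulr_rgt0 _ ltQ) (nmulr_rlt0 _ ltQ) subr_lt0 subr_gt0.
  by have [-> ->] := signs R x; have [-> ->] := signs rat y.
have signs (Q : realFieldType) (z : nat -> Q) :
    (0 < lin n.+1 c z) = (lin n (b c) z < z n) /\
    (lin n.+1 c z < 0) = (z n < lin n (b c) z).
  have gtQ : 0 < ratr c`_n :> Q by rewrite ltr0q.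
  by rewrite linE (pmulr_rgt0 _ gtQ) (pmulr_rlt0 _ gtQ) subr_lt0 subr_gt0.
by have [-> ->] := signs R x; have [-> ->] := signs rat y.
Qed.

(** Finitely many comparisons are involved, each of them the sign of a rational linear form in the
    values of [x]. *)
Lemma rational_model (R : realFieldType) (V : finType) (x : V -> R) :
  exists y : V -> rat, forall a b c d,
    (x a + x b <= x c + x d) = (y a + y b <= y c + y d).
Proof.
pose form (a b c d : V) : seq rat :=
  [seq ((v == a)%:R + (v == b)%:R) - ((v == c)%:R + (v == d)%:R) | v <- enum V].
have lin_form (Q : realFieldType) (z : nat -> Q) a b c d : lin #|V| (form a b c d) z =
    (z (enum_rank a) + z (enum_rank b)) - (z (enum_rank c) + z (enum_rank d)).
  have delta e : \sum_(i < #|V|) (enum_val i == e)%:R * z i = z (enum_rank e).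
    rewrite (bigD1 (enum_rank e)) //= enum_rankK eqxx mul1r big1 ?addr0 // => i ne.
    rewrite (_ : (_ == _) = false) ?mul0r //; apply: contraNF ne => /eqP <-.
    by rewrite enum_valK.
  rewrite -!delta -!big_split -sumrB; apply: eq_bigr => i _ /=.
  rewrite (nth_map a) -?cardE // -enum_val_nth.
  by rewrite rmorphB !rmorphD !rmorph_nat; ring.
pose x' i := nth 0 [seq x v | v <- enum V] i.
have x'E a : x' (enum_rank a) = x a.
  by rewrite /x' (nth_map a) -?cardE // -enum_val_nth enum_rankK.
pose s := [seq form t.1.1 t.1.2 t.2.1 t.2.2 | t : (V * V) * (V * V)].
have [y yP] := rational_signs #|V| s x'.
exists (fun v => y (enum_rank v)) => a b c d.
have [h _] := yP (form a b c d) (codom_f (fun t : (V * V) * (V * V) =>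
  form t.1.1 t.1.2 t.2.1 t.2.2) ((a, b), (c, d))).
have form_gt0 (Q : realFieldType) (z : nat -> Q) : (0 < lin #|V| (form a b c d) z) =
  ~~ (z (enum_rank a) + z (enum_rank b) <= z (enum_rank c) + z (enum_rank d)).
  by rewrite lin_form subr_gt0 ltNge.
by move: h; rewrite !form_gt0 !x'E => /(congr1 negb); rewrite !negbK.
Qed.

Lemma finite_multiple_exchange (R : realFieldType) (N : finType)
    (g : {set N} -> R) (X Y I : {set N}) :
  fin_mnat g -> I \subset X :\: Y ->
  exists2 J : {set N}, J \subset Y :\: X &
    g X + g Y <= g ((X :\: I) :|: J) + g ((Y :\: J) :|: I).
Proof.
move=> gM sI; have [q gq] := rational_model g.
have qM : fin_mnat q.
  move=> Z W i /gM[h|[j jWZ h]]; first by left; rewrite -gq.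
  by right; exists j => //; rewrite -gq.
by have [J sJ] := arch_multiple_exchange qM sI; rewrite -gq; exists J.
Qed.

(** * Regularization by a Hamming distance penalty *)

Section Regularization.
Variables (R : realFieldType) (N : finType).
Implicit Types (f : {set N} -> ext R) (C : R) (X Y Z W A B : {set N}).

(** A sum over elements, so that distances can be compared one element at a time. *)
Definition dist X Z := (\sum_e ((e \in X) (+) (e \in Z)))%N.

Lemma dist_eq0 X Z : dist X Z = 0%N -> X = Z.
Proof.
move/eqP; rewrite sum_nat_eq0 => /forallP h; apply/setP => e.
by have := h e; rewrite eqb0 /=; case: (e \in X); case: (e \in Z).
Qed.

Lemma in_dom f X : (X \in dom f) = (f X != None).
Proof. by rewrite /dom inE. Qed.

Definition fval f X : R := odflt 0 (f X).

Definition penalty f C X Z := fval f Z - C * (dist X Z)%:R.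

Definition reg f C Z0 X :=
  penalty f C X [arg max_(Z > Z0 | Z \in dom f) penalty f C X Z]%O.

Lemma reg_ge f C Z0 X Z : Z0 \in dom f -> Z \in dom f -> penalty f C X Z <= reg f C Z0 X.
Proof.
move=> Z0f Zf; rewrite /reg; case: Order.TotalTheory.arg_maxP => // W _; exact.
Qed.

Lemma reg_attained f C Z0 X : Z0 \in dom f ->
  exists2 Z, Z \in dom f & reg f C Z0 X = penalty f C X Z.
Proof.
by move=> Z0f; rewrite /reg; case: Order.TotalTheory.arg_maxP => // Z Zf _; exists Z.
Qed.

Lemma Mnat_dom_exchange f : Mnat_concave f ->
  forall Z W i, Z \in dom f -> W \in dom f -> i \in Z :\: W ->
  [/\ Z :\ i \in dom f, i |: W \in dom f &
      fval f Z + fval f W <= fval f (Z :\ i) + fval f (i |: W)] \/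
  exists2 j, j \in W :\: Z &
    [/\ j |: (Z :\ i) \in dom f, (i |: W) :\ j \in dom f &
      fval f Z + fval f W <= fval f (j |: (Z :\ i)) + fval f ((i |: W) :\ j)].
Proof.
case=> _ fM Z W i; rewrite !in_dom => Zf Wf iZW.
have := fM Z W i iZW.
rewrite /fval; case: (f Z) Zf => // z _; case: (f W) Wf => // w _.
rewrite {1}/emax; case: ifP => _; last first.
  case ez: (f (Z :\ i)) => [z'|//]; case ew: (f (i |: W)) => [w'|//] le.
  by left.
pose F j := eadd (f (j |: (Z :\ i))) (f ((i |: W) :\ j)).
(* A real number below a maximum that starts from [None] is below one of its terms. *)
suff sel (r : seq N) (P : pred N) :
    ele (Some (z + w)) (\big[@emax R/None]_(j <- r | P j) F j) ->
    exists2 j, P j & ele (Some (z + w)) (F j).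
  case/sel => j jWZ; rewrite /F.
  case ez: (f (j |: (Z :\ i))) => [z'|//]; case ew: (f ((i |: W) :\ j)) => [w'|//] le.
  by right; exists j; rewrite ?in_dom ?ez ?ew.
elim: r => [|j r IH]; first by rewrite big_nil.
rewrite big_cons; case: ifP => // Pj; rewrite {1}/emax; case: ifP => // _ le.
by exists j.
Qed.

(** Maximizers [Z] and [W] for [X] and [Y] are kept unless [i] lies in [Z :\: W], in which case
    exchange for [f] is applied to them. If its [j] is not in [Y :\: X], then [X] and [Y] exchange
    [i] alone. In all cases the total distance does not grow. *)
Lemma mnat_reg f C Z0 : 0 <= C -> Mnat_concave f -> Z0 \in dom f ->
  fin_mnat (reg f C Z0).
Proof.
move=> C_ge0 fM Z0f X Y i; rewrite inE => /andP[iY iX].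
have [Z Zf ->] := reg_attained C X Z0f; have [W Wf ->] := reg_attained C Y Z0f.
have le_reg X' Y' Z' W' : Z' \in dom f -> W' \in dom f ->
    fval f Z + fval f W <= fval f Z' + fval f W' ->
    (dist X' Z' + dist Y' W' <= dist X Z + dist Y W)%N ->
    penalty f C X Z + penalty f C Y W <= reg f C Z0 X' + reg f C Z0 Y'.
  move=> Zf' Wf' lef; rewrite -(ler_nat R) !natrD => led.
  have := reg_ge C X' Z0f Zf'; have := reg_ge C Y' Z0f Wf'.
  rewrite {2 4}/penalty; have := ler_wpM2l C_ge0 led; rewrite /penalty; lra.
have le_dist X' Y' Z' W' : (forall e,
    ((e \in X') (+) (e \in Z')) + ((e \in Y') (+) (e \in W')) <=
    ((e \in X) (+) (e \in Z)) + ((e \in Y) (+) (e \in W)))%N ->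
    (dist X' Z' + dist Y' W' <= dist X Z + dist Y W)%N.
  by move=> h; rewrite /dist -!big_split; apply: leq_sum => e _; apply: h.
have [iZ|iZ] := boolP (i \in Z); last first.
  left; apply: le_reg Zf Wf _ _ => //; apply: le_dist => e; rewrite !inE.
  case: eqVneq => //= ->; rewrite (negPf iZ) iX (negPf iY).
  by case: (i \in W).
have [iW|iW] := boolP (i \in W).
  left; apply: le_reg Zf Wf _ _ => //; apply: le_dist => e; rewrite !inE.
  by case: eqVneq => //= ->; rewrite iZ iX (negPf iY) iW.
have /(Mnat_dom_exchange fM Zf Wf) : i \in Z :\: W by rewrite inE iZ iW.
case=> [[Zf' Wf' lef]|[j]].
  left; apply: le_reg Zf' Wf' lef _; apply: le_dist => e; rewrite !inE.
  by case: eqVneq => //= ->; rewrite iX iZ (negPf iY) (negPf iW).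
rewrite inE => /andP[jZ jW] [Zf' Wf' lef].
have ji : j != i by apply: contraNneq jZ => ->.
have [jXY|jXY] := boolP (j \in Y :\: X).
  right; exists j => //; apply: le_reg Zf' Wf' lef _; apply: le_dist => e.
  move: jXY; rewrite !inE => /andP[jX jY].
  have [->|ej] := eqVneq e j.
    by rewrite (negPf ji) (negPf jX) jY jW (negPf jZ).
  by case: eqVneq => //= ->; rewrite iX iZ (negPf iY) (negPf iW).
left; apply: le_reg Zf' Wf' lef _; apply: le_dist => e.
move: jXY; rewrite !inE negb_and negbK => jXY.
have [->|ej] := eqVneq e j.
  rewrite (negPf ji) jW (negPf jZ) /=.
  by move: jXY; case: (j \in X); case: (j \in Y).
by case: eqVneq => //= ->; rewrite iX iZ (negPf iY) (negPf iW).
Qed.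

End Regularization.

Theorem theorem1 (R : realFieldType) (N : finType) (f : {set N} -> ext R) :
  Mnat_concave f ->
  forall (X Y I : {set N}), I \subset X :\: Y ->
    exists J : {set N}, J \subset Y :\: X /\
      ele (eadd (f X) (f Y)) (eadd (f ((X :\: I) :|: J)) (f ((Y :\: J) :|: I))).
Proof.
move=> fM X Y I sI.
have [Xf|] := boolP (X \in dom f); last first.
  by rewrite in_dom negbK => /eqP ->; exists set0; rewrite sub0set.
have [Yf|] := boolP (Y \in dom f); last first.
  by rewrite in_dom negbK => /eqP ->; exists set0; rewrite sub0set; case: (f X).
pose M := \sum_(Z : {set N}) `|fval f Z|.
have fvalM Z : - M <= fval f Z <= M.
  rewrite -ler_norml /M (bigD1 Z) //= lerDl sumr_ge0 // => W _.
have M_ge0 : 0 <= M by apply: sumr_ge0.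
(* Two sums of two values of [fval f] differ by at most [4 * M], so a positive total distance from
   the maximizers would violate the exchange inequality. *)
pose C := 4 * M + 1.
have C_ge0 : 0 <= C by rewrite /C; lra.
have [J sJ le] := finite_multiple_exchange (mnat_reg C_ge0 fM Xf) sI.
exists J; split=> //.
have dist0 Z : dist Z Z = 0%N by apply: big1 => e _; rewrite addbb.
have regX : fval f X <= reg f C X X.
  by have := reg_ge C X Xf Xf; rewrite /penalty dist0 mulr0 subr0.
have regY : fval f Y <= reg f C X Y.
  by have := reg_ge C Y Xf Yf; rewrite /penalty dist0 mulr0 subr0.
have [Z Zf eZ] := reg_attained C ((X :\: I) :|: J) Xf.
have [W Wf eW] := reg_attained C ((Y :\: J) :|: I) Xf.
move: le; rewrite eZ eW /penalty => le.
have [d0|d0] := posnP (dist ((X :\: I) :|: J) Z + dist ((Y :\: J) :|: I) W); last first.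
  have : C * 1 <= C * (dist ((X :\: I) :|: J) Z + dist ((Y :\: J) :|: I) W)%:R.
    by rewrite ler_wpM2l // ler1n.
  have := fvalM X; have := fvalM Y; have := fvalM Z; have := fvalM W.
  by rewrite natrD /C in le *; lra.
(* With both distances zero, the maximizers are the exchanged sets themselves, which therefore lie
   in [dom f]. *)
move/eqP: d0; rewrite addn_eq0 => /andP[/eqP dZ /eqP dW].
move: le; rewrite dZ dW mulr0 !subr0 (dist_eq0 dZ) (dist_eq0 dW).
move: Xf Yf Zf Wf regX regY; rewrite !in_dom /fval.
case: (f X) => // x _; case: (f Y) => // y _; case: (f Z) => // z _; case: (f W) => // w _ /=.
lra.
Qed.
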